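(* For integers $n$ and $\ell$ with $1\le \ell\le \lceil \log_2 n\rceil$, $$\ell\lceil \log_2 n\rceil-\binom{\ell+1}{2}<\hat{p}(P_n^\ell)<\ell\lceil \log_2 n\rceil-\ell\bigl(\lfloor \log_2 \ell\rfloor-1\bigr).$$
   Context: $P_n^\ell$ is the $\ell$th power of the $n$-vertex path: its vertices are $v_0,\dots,v_{n-1}$, and distinct $v_i,v_j$ are adjacent iff $|i-j|\le \ell$. An edge-coloring assigns a color to each edge; a walk is a parity walk if every color appears an even number of times along it (with multiplicity), and it is open if its endpoints are distinct. A strong parity edge-coloring is an edge-coloring with no open parity walk, and $\hat{p}(G)$ is the minimum number of colors in such a coloring of $G$. *)

(* Defs.v *)
From mathcomp Require Import all_boot all_order all_algebra.
From mathcomp Require Import boolp.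

Set Implicit Arguments.
Unset Strict Implicit.
Unset Printing Implicit Defensive.

Record sgraph := SGraph {
  vertex :> finType;
  adj : rel vertex;
  adj_sym : symmetric adj;
  adj_irrefl : irreflexive adj }.

(* The walk x, p_1, ..., p_k is encoded as in path.v, by its first vertex x and
   the sequence p of its remaining vertices; it ends at last x p. *)
Definition walk (G : sgraph) (x : G) (p : seq G) : bool := path (@adj G) x p.

Definition edges (G : sgraph) : {set {set G}} :=
  [set [set u.1; u.2] | u in [pred u : G * G | adj u.1 u.2]].

Definition walk_edges (G : sgraph) (x : G) (p : seq G) : seq {set G} :=
  pairmap (fun u v => [set u; v]) x p.

(* An edge-coloring is a map on {set G} of which only the values on edges G
   matter; colors are natural numbers. *)
Definition parity_walk (G : sgraph) (c : {set G} -> nat) (x : G)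
    (p : seq G) : Prop :=
  walk x p /\
  forall a : nat, ~~ odd (count_mem a [seq c f | f <- walk_edges x p]).

Definition strong_parity_coloring (G : sgraph) (c : {set G} -> nat) : Prop :=
  ~ exists x p, parity_walk c x p /\ x != last x p.

Definition strong_parity_colorable (G : sgraph) (k : nat) : Prop :=
  exists c : {set G} -> nat,
    {in edges G, forall f, c f < k} /\ strong_parity_coloring c.

Lemma odd_count_walk_edges (G : sgraph) (z x : G) (p : seq G) :
  walk x p ->
  odd (count (fun f : {set G} => z \in f) (walk_edges x p))
    = (z == x) (+) (z == last x p).
Proof.
rewrite /walk /walk_edges; elim: p x => [|y p IHp] x /=; first by rewrite addbb.
case/andP=> xy /IHp; rewrite oddD => ->; rewrite !inE oddb.
have: x != y by apply: contraTneq xy => ->; rewrite adj_irrefl.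
case: (eqVneq z x) => [->|_]; last by case: (z == y); case: (z == _).
by move/negbTE=> ->; case: (x == _).
Qed.

Lemma odd_count_even (T : finType) (a : pred T) (s : seq T) :
  (forall x, ~~ odd (count_mem x s)) -> ~~ odd (count a s).
Proof.
move=> even_s; suff ->: count a s = \sum_(x | a x) count_mem x s.
  by apply: (big_ind (fun m => ~~ odd m)) => // m n /negbTE om /negbTE on;
    rewrite oddD om on.
elim: s {even_s} => [|y s IHs] /=; first by rewrite big1.
rewrite big_split /= -IHs; congr (_ + _); case ay: (a y).
  rewrite (bigD1 y) //= eqxx big1 ?addn0 // => x /andP[_ /negbTE].
  by rewrite eq_sym => ->.
by rewrite big1 // => x ax; case: eqP => // xy; rewrite xy ax in ay.
Qed.

(* Giving distinct colors to distinct edges is a strong parity edge-coloring. *)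
Lemma strong_parity_colorable_card (G : sgraph) :
  strong_parity_colorable G #|{set G}|.
Proof.
exists (fun f => nat_of_ord (enum_rank f)); split=> [f _|]; first exact: ltn_ord.
case=> x [p [[xp even_c] xNlast]]; have := odd_count_walk_edges x xp.
rewrite eqxx (negbTE xNlast) /=; apply/negP; apply: odd_count_even => f.
have := even_c (enum_rank f); rewrite count_map; congr (~~ odd _).
by apply: eq_count => g /=; rewrite (inj_eq val_inj) (inj_eq enum_rank_inj).
Qed.

Lemma strong_parity_number_subproof (G : sgraph) :
  exists k, `[< strong_parity_colorable G k >].
Proof. by exists #|{set G}|; apply/asboolP/strong_parity_colorable_card. Qed.

Definition strong_parity_number (G : sgraph) : nat :=
  ex_minn (strong_parity_number_subproof G).

Section PathPower.
Variables n l : nat.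

Definition path_power_adj : rel 'I_n :=
  [rel i j : 'I_n | (i != j) && (`|i - j| <= l)].

Lemma path_power_adj_sym : symmetric path_power_adj.
Proof. by move=> i j; rewrite /path_power_adj /= eq_sym distnC. Qed.

Lemma path_power_adj_irrefl : irreflexive path_power_adj.
Proof. by move=> i; rewrite /path_power_adj /= eqxx. Qed.

Definition path_power : sgraph :=
  SGraph path_power_adj_sym path_power_adj_irrefl.

End PathPower.

(* Main.v *)
(* Upper bound: give vertex i the binary word of i and the edge ij the color
   i xor j, so that colors along a walk from x to y sum to x xor y.  If the top
   bit of i xor j is bit s, then 2^(s+1) - |i - j| <= i xor j < 2^(s+1); with
   k = trunc_log 2 l, only the colors in [1, 2^(k+1)) and the l colors below
   each 2^(s+1), k < s < m, occur.
   Lower bound: scan v_0, v_1, ... and maintain a set B of colors such that each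
   v_i seen is reached from v_0 by a walk on which all colors outside B are
   even.  The parities of the colors in B then determine v_i, so B ends with at
   least m = up_log 2 n colors.  Whenever B must grow, to its j-th color, the
   new vertex has at least min(l, j) backward edges, of distinct colors, all of
   them new: a backward edge sharing its color with an earlier edge would yield
   a walk from v_0 to the new vertex with even colors outside the old B.  Hence
   at least
   \sum_(1 <= j <= m) min(l, j) = l m - 'C(l, 2) colors are used. *)
From Stdlib Require Import PeanoNat.
From HB Require Import structures.
Require Import Defs.
From mathcomp Require Import all_boot all_order all_algebra.
From mathcomp Require Import boolp zify.

Set Implicit Arguments.
Unset Strict Implicit.
Unset Printing Implicit Defensive.

(** * Bitwise exclusive or and the upper bound *)

Lemma odd_NatoddE n : Nat.odd n = odd n.
Proof. by elim: n => // n IHn; rewrite Nat.odd_succ -Nat.negb_odd IHn. Qed.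

Lemma lxor_halfE i j :
  Nat.lxor i j = (odd i (+) odd j) + (Nat.lxor i./2 j./2).*2.
Proof.
have eq_div2 a : Nat.div2 a = a./2.
  by have := Nat.div2_odd a; rewrite odd_NatoddE; lia.
apply: Nat.bits_inj => -[|t]; rewrite Nat.lxor_spec.
  rewrite !Nat.bit0_odd !odd_NatoddE oddD odd_double addbF oddb.
  by case: (odd i); case: (odd j).
by rewrite -!Nat.testbit_div2 !eq_div2 half_bit_double Nat.lxor_spec.
Qed.

HB.instance Definition _ := Monoid.isComLaw.Build nat 0 Nat.lxor
  (fun a b c => esym (Nat.lxor_assoc a b c)) Nat.lxor_comm Nat.lxor_0_l.

(** Induction on halves: restoring the last bits doubles both xor and difference, and adds a
    nonnegative amount to their sum. *)
Lemma lxor_near_pow2 i j : i < j ->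
  exists s, [/\ 2 ^ s <= j, 2 ^ s <= Nat.lxor i j < 2 ^ s.+1
              & 2 ^ s.+1 <= Nat.lxor i j + (j - i)].
Proof.
elim/ltn_ind: j i => j IHj i ltij; rewrite lxor_halfE.
have ei := odd_double_half i; have ej := odd_double_half j.
have [eqij|neqij] := eqVneq i./2 j./2.
  exists 0; rewrite eqij Nat.lxor_nilpotent; move: ei ej.
  by case: (odd i); case: (odd j) => /= ei ej; split; lia.
have [||s [sj /andP[s1 s2] s3]] := IHj j./2 _ i./2; [lia | lia |].
exists s.+1; rewrite !(expnS 2 s.+1).
rewrite !expnS in sj s1 s2 s3 *; move: ei ej.
by case: (odd i); case: (odd j) => /= ei ej; split; lia.
Qed.

Lemma big_lxor_even (s : seq nat) (F : nat -> nat) :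
  (forall a, ~~ odd (count_mem a s)) -> \big[Nat.lxor/0]_(a <- s) F a = 0.
Proof.
move=> even_s; rewrite -big_undup_iterop_count big1 // => a _.
rewrite -[count_mem _ _]odd_double_half (negbTE (even_s a)) add0n.
rewrite Monoid.iteropE; elim: (_./2) => // t IHt.
by rewrite doubleS !iterS IHt Monoid.mulm1; exact: Nat.lxor_nilpotent.
Qed.

Lemma walk_lxor_potential (G : sgraph) (h : G -> nat) (F : {set G} -> nat) x p :
  (forall u v, adj u v -> F [set u; v] = Nat.lxor (h u) (h v)) -> walk x p ->
  \big[Nat.lxor/0]_(f <- walk_edges x p) F f = Nat.lxor (h x) (h (last x p)).
Proof.
move=> hF; elim: p x => [|y p IHp] x /=.
  by rewrite big_nil Nat.lxor_nilpotent.
case/andP=> xy /IHp IH; rewrite /walk_edges /= big_cons IH hF //.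
rewrite Nat.lxor_assoc -(Nat.lxor_assoc (h y)).
by rewrite Nat.lxor_nilpotent Nat.lxor_0_l.
Qed.

(** Xors of labels telescope along a walk, so a parity walk has endpoints with equal labels. *)
Lemma lxor_potential_colorable (G : sgraph) (h : G -> nat) (C : seq nat) :
  injective h -> (forall u v, adj u v -> Nat.lxor (h u) (h v) \in C) ->
  strong_parity_colorable G (size C).
Proof.
move=> h_inj hC; pose F (f : {set G}) := \big[Nat.lxor/0]_(u in f) h u.
have FE u v : adj u v -> F [set u; v] = Nat.lxor (h u) (h v).
  move=> uv; rewrite /F big_setU1 ?big_set1 // inE.
  by apply: contraTneq uv => ->; rewrite adj_irrefl.
exists (fun f => index (F f) C); split.
  by move=> f /imsetP[[u v] uv ->]; rewrite index_mem FE // hC.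
case=> x [p [[xp even_p] /eqP[]]]; apply/h_inj/Nat.lxor_eq.
rewrite -(walk_lxor_potential FE xp).
rewrite -[RHS](big_lxor_even (nth 0 C) even_p) big_map.
have {xp}: all (fun f => F f \in C) (walk_edges x p).
  elim: p x xp {even_p} => //= y p IHp x /andP[xy /IHp ->].
  by rewrite FE // hC.
elim: (walk_edges x p) => [|f s IHs] /=; first by rewrite !big_nil.
by case/andP=> fC /IHs; rewrite !big_cons nth_index // => ->.
Qed.

Lemma path_power_colorable n l : 0 < l -> l <= up_log 2 n ->
  exists2 K, K < l * (up_log 2 n - (trunc_log 2 l) + 1)
           & strong_parity_colorable (path_power n l) K.
Proof.
move=> l_gt0 le_l_m; set m := up_log 2 n; set k := trunc_log 2 l.
have le_n : n <= 2 ^ m by exact: up_logP.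
have le_kl : 2 ^ k <= l by exact: trunc_logP.
have lt_lk : l < 2 ^ k.+1 by exact: trunc_log_ltn.
have lt_km : k < m.
  by apply: leq_trans le_l_m; apply: leq_trans le_kl; exact: ltn_expl.
pose C := iota 1 (2 ^ k.+1).-1 ++
          flatten [seq iota (2 ^ s.+1 - l) l | s <- iota k.+1 (m - k.+1)].
exists (size C).
  rewrite size_cat size_iota size_flatten sumnE !big_map.
  under eq_bigr do rewrite size_iota.
  rewrite big_const_seq count_predT size_iota iter_addn addn0.
  (* Since [2 ^ k <= l], the first block has fewer than [2 * l] colors; each of the other [m - k.+1]
     blocks has [l]. *)
  rewrite expnS in lt_lk *.
  nia.
apply: (@lxor_potential_colorable (path_power n l) (fun i : 'I_n => val i)).
  exact: val_inj.
have lxorC (i j : 'I_n) : i < j -> j - i <= l -> Nat.lxor i j \in C.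
  move=> ltij ijl; have [s [sj /andP[s1 s2] s3]] := lxor_near_pow2 ltij.
  have sm : s < m.
    rewrite -(ltn_exp2l (m := 2)) //; apply: leq_ltn_trans sj _.
    exact: leq_trans (ltn_ord j) le_n.
  rewrite mem_cat; have [sk|ks] := leqP s k; apply/orP; [left | right].
    have := leq_pexp2l (m := 2) isT (sk : s.+1 <= k.+1).
    by have := expn_gt0 2 s; rewrite mem_iota; lia.
  apply/flatten_mapP; exists s; rewrite mem_iota; first lia.
  have := leq_pexp2l (m := 2) isT (ks : k.+1 <= s).
  by rewrite expnS in s2 s3 *; lia.
move=> i j /andP[/= neq_ij ij_l].
have [ltij|ltji|/val_inj eqij] := ltngtP (val i) (val j).
- by apply: lxorC => //; lia.
- by rewrite Nat.lxor_comm; apply: lxorC => //; lia.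
- by rewrite eqij eqxx in neq_ij.
Qed.

(** * Color parities of walks and the lower bound *)

Section ParityOfWalks.
Context {G : sgraph} (c : {set G} -> nat).

(** [P] is the parity vector of a walk over the field with two elements: concatenation adds such
    vectors, reversal preserves them. *)
Definition joined (x y : G) (P : nat -> bool) : Prop :=
  exists p, [/\ walk x p, last x p = y
    & forall a, odd (count_mem a [seq c f | f <- walk_edges x p]) = P a].

Lemma joined_refl x : joined x x (fun=> false).
Proof. by exists [::]. Qed.

Lemma joined_edge x y : adj x y -> joined x y (pred1 (c [set x; y])).
Proof.
move=> xy; exists [:: y]; split; rewrite /walk /= ?xy // => a.
by rewrite addn0 oddb.
Qed.

Lemma joined_trans x y z P Q :
  joined x y P -> joined y z Q -> joined x z (fun a => P a (+) Q a).
Proof.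
move=> [p [xp <- hP]] [q [yq <- hQ]]; exists (p ++ q).
rewrite /walk cat_path last_cat; split=> //; first exact/andP.
by move=> a; rewrite /walk_edges pairmap_cat map_cat count_cat oddD hP hQ.
Qed.

Lemma eq_joined x y P Q : P =1 Q -> joined x y P -> joined x y Q.
Proof.
by move=> eqPQ [p [xp py hP]]; exists p; split=> // a; rewrite hP eqPQ.
Qed.

Lemma joined_sym x y P : joined x y P -> joined y x P.
Proof.
move=> [p [xp <- hP]]; apply: eq_joined hP _; elim: p x xp => [|y' p IHp] x.
  by move=> _; exact: joined_refl.
case/andP=> xy' /IHp jp; have yx : adj y' x by rewrite adj_sym.
apply: eq_joined (joined_trans jp (joined_edge yx)) => a.
by rewrite /= oddD oddb setUC addbC eq_sym.
Qed.

Definition spanned (B : seq nat) (x y : G) : Prop :=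
  exists2 P, joined x y P & forall a, a \notin B -> P a = false.

Hypothesis c_strong : strong_parity_coloring c.

Lemma joined_even x y P : P =1 xpred0 -> joined x y P -> x = y.
Proof.
move=> P0 [p [xp py hP]]; apply/eqP/negP => /negP neq_xy; apply: c_strong.
by exists x, p; rewrite py; split=> //; split=> // a; rewrite hP P0.
Qed.

(** The coloring is proper, as otherwise the walk [x], [u], [y] would be an open parity walk. *)
Lemma adj_color_inj u x y :
  adj x u -> adj y u -> c [set x; u] = c [set y; u] -> x = y.
Proof.
move=> xu yu eq_c; have := joined_sym (joined_edge yu).
move=> /(joined_trans (joined_edge xu)); apply: joined_even => a.
by rewrite /= eq_c addbb.
Qed.

(** Walk from [o] to [x], [y], back to [o], then to [u], [w]: the two edges of equal color cancel
    modulo 2. *)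
Lemma spanned_same_color B o x y u w :
    spanned B o x -> spanned B o y -> spanned B o u -> adj x y -> adj u w ->
  c [set x; y] = c [set u; w] -> spanned B o w.
Proof.
move=> [P jP hP] [Q jQ hQ] [S jS hS] xy uw eq_c.
have jxy := joined_trans jP (joined_edge xy).
have jo := joined_trans jxy (joined_sym jQ).
have juw := joined_trans jS (joined_edge uw).
eexists; first exact: joined_trans jo juw.
by move=> a aB; rewrite /= hP // hQ // hS // eq_c addbF addbb.
Qed.

Variables (v : nat -> G) (N : nat).
Hypothesis v_inj : forall i j, i <= N -> j <= N -> v i = v j -> i = j.

(** Two vertices with the same parities on [B] would be joined, through [v 0], by a walk with all
    parities even. *)
Lemma spanned_card B :
  (forall i, i <= N -> spanned B (v 0) (v i)) -> N < 2 ^ size B.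
Proof.
move=> hB; have /choice[P hP] (i : 'I_N.+1) : exists P,
    joined (v 0) (v i) P /\ forall a, a \notin B -> P a = false.
  by have [P jP oP] := hB i (ltn_ord i); exists P.
pose g i := map_tuple (P i) (in_tuple B).
have g_inj : injective g.
  move=> i j /(congr1 val)/= /eq_in_map eqP.
  apply/val_inj/v_inj; rewrite ?leq_ord //.
  have [[ji oi] [jj oj]] := (hP i, hP j).
  apply: joined_even (joined_trans (joined_sym ji) jj) => a.
  have [/eqP ->|aB] := boolP (a \in B); first exact: addbb.
  by rewrite oi // oj.
by have := leq_card g g_inj; rewrite card_ord card_tuple card_bool.
Qed.

Variable l : nat.
Hypothesis l_gt0 : 0 < l.
Hypothesis v_adj : forall i j, i < j <= N -> j - i <= l -> adj (v i) (v j).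

Lemma spanning_colors t : t <= N -> exists B E : seq nat,
  [/\ size B <= t /\ (forall i, i <= t -> spanned B (v 0) (v i)),
      uniq E,
      forall a, a \in E -> exists i j,
        [/\ i <= t, j <= t, adj (v i) (v j) & a = c [set v i; v j]]
    & \sum_(1 <= j < (size B).+1) minn l j <= size E].
Proof.
elim: t => [_|t IHt ltN].
  exists [::], [::]; split; rewrite ?big_geq //; split=> // i.
  by rewrite leqn0 => /eqP ->; exists (fun=> false) => //; exact: joined_refl.
have [B [E [[sB hB] uE hE sE]]] := IHt (ltnW ltN).
have hE' a : a \in E -> exists i j,
    [/\ i <= t.+1, j <= t.+1, adj (v i) (v j) & a = c [set v i; v j]].
  by move=> /hE[i [j [it jt vij ->]]]; exists i, j; split=> //; exact: leqW.
have [spt|nspt] := pselect (spanned B (v 0) (v t.+1)).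
  exists B, E; split=> //; split; first exact: leqW.
  by move=> i; rewrite leq_eqVlt => /predU1P[->|/hB].
(* These are the colors of the backward edges at [v t.+1], nearest neighbor first. *)
pose b i := c [set v (t - i); v t.+1]; pose s := iota 0 (minn l t.+1).
have s_adj i : i \in s -> adj (v (t - i)) (v t.+1).
  by rewrite mem_iota => i_s; apply: v_adj; lia.
have ub : uniq [seq b i | i <- s].
  rewrite map_inj_in_uniq ?iota_uniq // => i j i_s j_s eq_b.
  have := adj_color_inj (s_adj i i_s) (s_adj j j_s) eq_b.
  by move/v_inj; move: i_s j_s; rewrite !mem_iota; lia.
(* Adding the color of the edge from [v t], already spanned, suffices to span [v t.+1]. *)
exists (b 0 :: B), ([seq b i | i <- s] ++ E); split.
- split=> // i; rewrite leq_eqVlt => /predU1P[->|].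
    have [P jP oP] := hB t (leqnn t).
    have vt : adj (v t) (v t.+1) by apply: v_adj; lia.
    eexists; first exact: joined_trans jP (joined_edge vt).
    move=> a; rewrite inE negb_or => /andP[ab aB]; rewrite /= oP //=.
    by move: ab; rewrite /b subn0 => /negbTE.
  rewrite ltnS => /hB[P jP oP]; exists P => // a.
  by rewrite inE negb_or => /andP[_ /oP].
- rewrite cat_uniq ub uE andbT; apply/hasPn => a /hE[i [j [it jt vij ->]]].
  apply/mapP => -[r r_s eq_b]; apply: nspt.
  apply: (spanned_same_color (hB i it) (hB j jt) _ vij (s_adj r r_s)) => //.
  by apply: hB; exact: leq_subr.
- move=> a; rewrite mem_cat => /orP[/mapP[i i_s ->]|/hE' //].
  by exists (t - i), t.+1; split=> //; [exact/leqW/leq_subr | exact: s_adj].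
(* The new summand [minn l (size B).+1] is at most [minn l t.+1] because [size B <= t]. *)
- rewrite size_cat size_map size_iota big_nat_recr //= addnC leq_add //.
  by lia.
Qed.

End ParityOfWalks.

(** The deficits [l - j] for [1 <= j < l] add up to ['C(l, 2)]. *)
Lemma leq_sum_minn l b : l * b <= \sum_(1 <= j < b.+1) minn l j + 'C(l, 2).
Proof.
rewrite big_add1; elim: l b => [//|l IHl] [|b]; first by rewrite muln0.
have := IHl b; rewrite binS bin1 big_nat_recl //=.
under [in X in _ -> X]eq_bigr do rewrite minnSS -addn1.
by rewrite big_split /= sum_nat_const_nat; lia.
Qed.

Lemma path_power_lower n l K : 0 < l <= up_log 2 n ->
  strong_parity_colorable (path_power n l) K -> l * up_log 2 n <= K + 'C(l, 2).
Proof.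
case/andP=> l_gt0 le_l; case: n le_l => [|N] le_l [c [cK c_strong]].
  by rewrite up_log0 in le_l; lia.
pose v i : path_power N.+1 l := (inord i : 'I_N.+1).
have v_inj i j : i <= N -> j <= N -> v i = v j -> i = j.
  by move=> iN jN /(congr1 val); rewrite /= !inordK.
have v_adj i j : i < j <= N -> j - i <= l -> adj (v i) (v j).
  case/andP=> ij jN ijl; apply/andP.
  rewrite -(inj_eq val_inj) /= !inordK //; lia.
have [B [E [[_ hB] uE hE sE]]] :=
  spanning_colors c_strong v_inj l_gt0 v_adj (leqnn N).
(* [N < 2 ^ size B] says that the number [N.+1] of vertices is at most [2 ^ size B]. *)
have le_B : up_log 2 N.+1 <= size B.
  by apply: up_log_min => //; exact: (spanned_card c_strong v_inj).
have le_K : size E <= K.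
  rewrite -(size_iota 0 K); apply: uniq_leq_size => // a.
  move=> /hE[i [j [_ _ vij ->]]].
  by rewrite mem_iota cK //; apply/imsetP; exists (v i, v j).
apply: leq_trans (leq_mul (leqnn l) le_B) _.
apply: leq_trans (leq_sum_minn l (size B)) _.
by rewrite leq_add2r (leq_trans sE).
Qed.

Local Open Scope ring_scope.

Theorem theorem1p11 (n l : nat) (hl : (1 <= l <= up_log 2 n)%N) :
  l%:Z * (up_log 2 n)%:Z - 'C(l.+1, 2)%:Z
    < (strong_parity_number (path_power n l))%:Z
    < l%:Z * (up_log 2 n)%:Z - l%:Z * ((trunc_log 2 l)%:Z - 1).
Proof.
rewrite /strong_parity_number; case: ex_minnP => p /asboolP col_p p_min.
have lower := path_power_lower hl col_p; case/andP: hl => l_gt0 le_l.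
have [K lt_K /asboolP/p_min le_pK] := path_power_colorable l_gt0 le_l.
have lt_l : (trunc_log 2 l < l)%N.
  exact: leq_trans (ltn_expl _ _) (@trunc_logP 2 l isT l_gt0).
(* Strictness comes from ['C(l.+1, 2) = 'C(l, 2) + l] and [0 < l]. *)
apply/andP; split; first by rewrite binS bin1; lia.
(* This makes the truncated subtraction in [lt_K] agree with the integer one. *)
have : (trunc_log 2 l <= up_log 2 n)%N by exact: ltnW (leq_trans lt_l le_l).
nia.
Qed.
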